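(* Let $A_C\in\mathbb{R}^{n\times n}$ be a companion matrix with characteristic polynomial $N(s)$ and $n$ distinct eigenvalues $\lambda_1,\dots,\lambda_n$, and suppose the system $\dot x(t)=A_Cx(t)+e_nu(t)$ is stable (all $\lambda_i$ have negative real part). Let $x_0\in\mathbb{R}^n$ be a reachable state, let $P_C$ be the solution of $A_CP_C+P_CA_C^T=-e_ne_n^T$, and let $E_{min}=x_0^TP_C^{-1}x_0$ be the minimum energy $\int_{-\infty}^0u^T(t)u(t)\,dt$ needed to bring the system from the zero state at $t=-\infty$ to $x_0$ at $t=0$. Define $$\tilde P_j^{-C}=\left\{\frac{N(-\lambda_j)}{-N'(\lambda_j)}\mathcal{J}y_jy_j^T\right\}_H,\qquad P_{ij}^{-C}=\left\{\frac{N(-\lambda_i^* )N(-\lambda_j)}{-N'(\lambda_i^* )N'(\lambda_j)}\cdot\frac{(y_i^* )^Ty_j^T}{\lambda_i^*+\lambda_j}\right\}_H,$$ and $x_{i0}=R_ix_0$ with $R_i=\dfrac{x_iy_i^T}{-N'(\lambda_i)}$, so that $x_0=\sum_ix_{i0}$. Then $E_{min}$ is partitioned into real parts corresponding to the components $x_{i0}$ of $x_0$ in the eigenbasis of $A_C$: $$E_{min}=x_0^TP_C^{-1}x_0=\sum_{i=1}^nE_i=\sum_{i,j=1}^n\hat E_{ij},$$ where $$E_i=x_0^T\tilde P_i^{-C}x_0=\frac12\left(x_{i0}^*P_C^{-1}x_0+x_0^*P_C^{-1}x_{i0}\right),$$ $$\hat E_{ij}=x_0^TP_{ij}^{-C}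x_0=\frac12\left(x_{i0}^*P_C^{-1}x_{j0}+x_{j0}^*P_C^{-1}x_{i0}\right).$$
   Context: The companion matrix is $A_C=\begin{bmatrix}0_{(n-1)\times 1}&I_{(n-1)\times(n-1)}\\-a_0&-a_1\ \cdots\ -a_{n-1}\end{bmatrix}$ with real $a_0,\dots,a_{n-1}$, so $N(s)=\det(sI-A_C)=\sum_{k=0}^na_ks^k$ with $a_n=1$; $e_n=[0,\dots,0,1]^T$. $x_i=[1,\lambda_i,\dots,\lambda_i^{n-1}]^T$ and $y_i=\lambda_i^{-n}\mathcal{H}_lx_i$, where $\mathcal{H}_l$ is the $n\times n$ lower Hankel matrix with $(\mathcal{H}_l)_{rc}=a_{r+c-n-1}$ if $r+c\ge n+1$ and $0$ otherwise; these are right and left eigenvectors of $A_C$ for $\lambda_i$, and $R_i$ is the residue of the resolvent $(sI-A_C)^{-1}$ at $\lambda_i$. $\mathcal{J}=\mathrm{diag}(-1,(-1)^2,\dots,(-1)^n)$. $(\cdot)^*$ is the complex conjugate transpose (conjugate for scalars), so $(y_i^* )^T$ is the column vector of conjugates of the entries of $y_i$; $\{M\}_H=\tfrac12(M+M^* )$ is the Hermitian part. The identity $E_{min}=x_0^TP_C^{-1}x_0$ is the standard known characterization of the minimum energy. *)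

(* Defs.v *)
From HB Require Import structures.
From mathcomp Require Import all_boot all_order all_algebra.
From mathcomp Require Import sesquilinear spectral.
From mathcomp Require Import all_classical all_reals all_analysis.
From mathcomp Require Import complex.

Set Implicit Arguments.
Unset Strict Implicit.
Unset Printing Implicit Defensive.

Import Order.TTheory GRing.Theory Num.Theory.
Import numFieldNormedType.Exports.

Local Open Scope classical_set_scope.
Local Open Scope sesquilinear_scope.
Local Open Scope complex_scope.
Local Open Scope ring_scope.

Section Control.
Variables (R : realType) (n : nat) (A : 'M[R]_n) (b : 'cV[R]_n).

(* Caratheodory solution of x' = A x + b u on ]-oo, 0]: u is locally integrable
   and the differential equation holds in integrated form, so that no
   regularity of the scalar input u is imposed. Values at t > 0 are
   irrelevant. *)
Definition trajectory (u : R -> R) (x : R -> 'cV[R]_n) : Prop :=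
  [/\ forall s, s <= 0 ->
        (@lebesgue_measure R).-integrable `[s, 0] (EFin \o u),
      forall i, {within `]-oo, 0], continuous (fun t => x t i 0)}
    & forall s t i, s <= t -> t <= 0 ->
        x t i 0 = x s i 0 +
          \int[@lebesgue_measure R]_(r in `[s, t]) (A *m x r + u r *: b) i 0].

(* u drives the system from the zero state at -oo to x0 at time 0. *)
Definition steers (u : R -> R) (x0 : 'cV[R]_n) : Prop :=
  exists x : R -> 'cV[R]_n,
    [/\ trajectory u x,
        forall i, x t i 0 @[t --> -oo] --> (0 : R)
      & x 0 = x0].

Definition reachable (x0 : 'cV[R]_n) : Prop := exists u, steers u x0.

Definition energy (u : R -> R) : \bar R :=
  (\int[@lebesgue_measure R]_(t in `]-oo, 0%R]) ((u t) ^+ 2)%:E)%E.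

(* E is the minimum, and not merely the infimum, of the energies of the inputs
   that drive the system to x0. *)
Definition is_min_energy (x0 : 'cV[R]_n) (E : R) : Prop :=
  (exists2 u, steers u x0 & energy u = E%:E) /\
  (forall u, steers u x0 -> (E%:E <= energy u)%E).

End Control.

Notation toC M := (map_mx (real_complex _) M).

Definition hermpart (C : numClosedFieldType) n (M : 'M[C]_n) : 'M[C]_n :=
  2^-1 *: (M + M ^t*).

(* In this section a_k is the coefficient N`_k of the monic polynomial N. Its
   companion matrix is [companionmx N], of size n = (size N).-1 = deg N, and
   [companionmxK] gives N(s) = det (s I - companionmx N). Row and column
   indices start at 0. *)
Section Companion.
Variables (R : realType) (N : {poly R}).
Local Notation n := (size N).-1.
Local Notation C := R[i].

Definition NC : {poly C} := map_poly (real_complex R) N.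

Definition e_last : 'cV[R]_n := \col_i (i.+1 == n)%:R.

(* The 1-based entry a_{r+c-n-1} for r + c >= n + 1 has the 0-based form
   a_{r+c+1-n} for r + c + 1 >= n. *)
Definition lower_hankel : 'M[R]_n :=
  \matrix_(r, c) if (n <= r + c + 1)%N then N`_(r + c + 1 - n) else 0.

Definition sign_mx : 'M[C]_n := diag_mx (\row_k (-1) ^+ k.+1).

Definition right_ev (l : C) : 'cV[C]_n := \col_k l ^+ k.

Definition left_ev (l : C) : 'cV[C]_n :=
  l ^- n *: (toC lower_hankel *m right_ev l).

(* The residue of the resolvent (s I - companionmx N)^-1 at a simple
   eigenvalue l. *)
Definition residue (l : C) : 'M[C]_n :=
  (- NC^`().[l])^-1 *: (right_ev l *m (left_ev l)^T).

Definition Ptilde (l : C) : 'M[C]_n :=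
  hermpart ((NC.[- l] / - NC^`().[l]) *:
            (sign_mx *m left_ev l *m (left_ev l)^T)).

Definition Ppair (li lj : C) : 'M[C]_n :=
  hermpart ((NC.[- li^*] * NC.[- lj] / (- NC^`().[li^*] * NC^`().[lj])
             / (li^* + lj)) *:
            (((left_ev li) ^t*)^T *m (left_ev lj)^T)).

End Companion.

(* Main.v *)
Require Import Defs.
From HB Require Import structures.
From mathcomp Require Import all_boot all_order all_algebra.
From mathcomp Require Import sesquilinear spectral.
From mathcomp Require Import all_classical all_reals all_analysis.
From mathcomp Require Import complex.
From mathcomp Require Import measurable_realfun zify ring.

Set Implicit Arguments.
Unset Strict Implicit.
Unset Printing Implicit Defensive.

Import Order.TTheory GRing.Theory Num.Theory.
Import numFieldNormedType.Exports.

Local Open Scope sesquilinear_scope.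
Local Open Scope complex_scope.
Local Open Scope ring_scope.

(** Write A for the companion matrix, e for the last basis vector, and x_m for
    the vector of powers of m, for any complex m.

    Algebra. Two relations give all the identities: the defect equation
    A x_m = m x_m - N(m) e ([companion_right_ev]), valid for every m, and
    y_i^T A = lambda_i y_i^T with last entry of y_i equal to -1
    ([companion_left_ev], [left_ev_last]). Pairing them gives
    (lambda_i - m) y_i^T x_m = N(m), hence the biorthogonality of the x_j and
    y_i, and the residues sum to 1 ([sum_residue]). Applied to y_j, the
    Lyapunov equation becomes (A + lambda_j) (P y_j) = e, which the vector
    - x_(- lambda_j) / N(- lambda_j) solves too; by stability A + lambda_j is
    injective, so P y_j is known explicitly ([gramian_left_ev]). It follows
    that P is symmetric and invertible. Moreover P has a checkerboard pattern of
    zeros, so it commutes with the sign matrix J, and J x_j = - x_(- lambda_j)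
    turns the formula for P y_j into P^-1 x_j = N(- lambda_j) J y_j
    ([invgramian_right_ev]). The formulas for the two energy partitions are
    this identity and its pairing with the conjugate eigenvectors
    ([Ptilde_form], [Ppair_form]).

    Minimum energy. Let p be the solution of p' = - A^T p with
    p(0) = P^-1 x0; it is a combination of decaying exponentials as t tends to
    - oo ([exists_costate]). By the Lyapunov equation the state P p solves the
    controlled equation for the input e^T p, whose square is the derivative of
    p^T P p; so this input steers the system to x0 with energy x0^T P^-1 x0
    ([input_steers], [input_energy]). For another admissible input u with
    trajectory x, the function p^T x has derivative (e^T p) u, so the integral
    of 2 (e^T p) u - (e^T p)^2 over [s, 0] is a boundary term; it is at most
    the integral of u^2, and it tends to x0^T P^-1 x0 as s tends to - oo
    ([input_minimal]). Since u is merely integrable, that derivative is taken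
    in integrated form ([Rintegral_product_rule]). *)

(** * Integration on segments *)

Section IntegralOnSegments.
Local Open Scope classical_set_scope.
Variable R : realType.
Local Notation mu := (@lebesgue_measure R).
Implicit Types (f g F : R -> R) (a b : R).

Lemma continuous_integrable f a b :
  {within `[a, b], continuous f} -> mu.-integrable `[a, b] (EFin \o f).
Proof. by apply: continuous_compact_integrable; exact: segment_compact. Qed.

Lemma segment_bounded f a b : {within `[a, b], continuous f} ->
  exists2 M : R, 0 <= M & forall t, a <= t <= b -> `|f t| <= M.
Proof.
move=> cf; have cK := continuous_compact cf (@segment_compact _ a b).
have [M [_ Mf]] := compact_bounded cK.
exists (`|M| + 1); first by rewrite addr_ge0.
move=> t tab; apply: (Mf (`|M| + 1)).
  by rewrite (le_lt_trans (ler_norm _)) // ltrDl.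
by exists t => //=; rewrite in_itv.
Qed.

Lemma integrable_continuousM f g a b : {within `[a, b], continuous f} ->
  mu.-integrable `[a, b] (EFin \o g) ->
  mu.-integrable `[a, b] (EFin \o (fun t => f t * g t)).
Proof.
move=> cf ig; have [M M0 fM] := segment_bounded cf.
apply: (@integrableMr _ _ _ mu _ _ f (EFin \o g)) => //.
  by apply: subspace_continuous_measurable_fun.
exists M; split; rewrite ?num_real // => r Mr t tab.
by apply: le_trans (fM t _) (ltW Mr); move: tab; rewrite /= in_itv.
Qed.

Lemma integrable_lincomb (c d : R) f g (D : set R) : measurable D ->
  mu.-integrable D (EFin \o f) -> mu.-integrable D (EFin \o g) ->
  mu.-integrable D (EFin \o (fun t => c * f t + d * g t)).
Proof.
move=> mD fi gi.
have := @integrableD _ _ _ mu D mD _ _ (@integrableZl _ _ _ mu D mD c _ fi)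
  (@integrableZl _ _ _ mu D mD d _ gi).
by apply: eq_integrable.
Qed.

Lemma integrable_add f g (D : set R) : measurable D ->
  mu.-integrable D (EFin \o f) -> mu.-integrable D (EFin \o g) ->
  mu.-integrable D (EFin \o (fun t => f t + g t)).
Proof.
move=> mD fi gi; have -> : (fun t => f t + g t) = (fun t => 1 * f t + 1 * g t).
  by apply/funext => t; rewrite !mul1r.
exact: integrable_lincomb.
Qed.

Lemma Rintegral_lincomb (c d : R) f g (D : set R) : measurable D ->
  mu.-integrable D (EFin \o f) -> mu.-integrable D (EFin \o g) ->
  \int[mu]_(t in D) (c * f t + d * g t) =
  c * \int[mu]_(t in D) f t + d * \int[mu]_(t in D) g t.
Proof.
move=> mD fi gi; rewrite RintegralD //; first by rewrite !RintegralZl.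
- exact: (@integrableZl _ _ _ mu D mD c _ fi).
- exact: (@integrableZl _ _ _ mu D mD d _ gi).
Qed.

Lemma integrable_subitv f a b s t : a <= s -> t <= b ->
  mu.-integrable `[a, b] (EFin \o f) -> mu.-integrable `[s, t] (EFin \o f).
Proof.
move=> sa tb; apply: integrableS => //.
by apply: subset_itv; rewrite bnd_simp.
Qed.

Lemma Rintegral_chasles f a s b : a <= s -> s <= b ->
  mu.-integrable `[a, b] (EFin \o f) ->
  \int[mu]_(r in `[a, b]) f r =
  \int[mu]_(r in `[a, s]) f r + \int[mu]_(r in `[s, b]) f r.
Proof.
move=> sa sb fi; apply/eqP; rewrite addrC -subr_eq; apply/eqP.
rewrite Rintegral_itvB ?bnd_simp // Rintegral_itv_obnd_cbnd //.
by apply: integrableS fi => //; apply: subset_itvr; rewrite bnd_simp.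
Qed.

(** The fundamental theorem of calculus for a primitive defined on the whole
    line, which needs no one-sided limits. *)
Lemma Rintegral_derivative f F a b : a <= b -> continuous f ->
  (forall t : R, is_derive t 1 F (f t)) ->
  \int[mu]_(r in `[a, b]) f r = F b - F a.
Proof.
rewrite le_eqVlt => /predU1P[->|ab] cf dF.
  by rewrite set_itv1 Rintegral_set1 subrr.
have cF : continuous F.
  move=> t; apply: differentiable_continuous; apply/derivable1_diffP.
  by have [] := dF t.
rewrite /Rintegral (continuous_FTC2 (F := F)) //.
- by apply: continuous_subspaceT.
- split; first by move=> t _; have [] := dF t.
  + by apply: cvg_at_right_filter; exact: cF.
  + by apply: cvg_at_left_filter; exact: cF.
- by move=> t _; rewrite derive1E; have [_ ->] := dF t.
Qed.

(** Cutting [a, b] into m equal pieces divides the sum of the bounds by m. This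
    replaces differentiability almost everywhere in the proof of the product
    rule below. *)
Lemma product_bounded_increments_cst F (phi : R -> R) a b : a <= b ->
  (forall s t, a <= s -> s <= t -> t <= b ->
     `|F t - F s| <= (t - s) * (phi t - phi s)) ->
  F b = F a.
Proof.
move=> ab incr; apply/eqP; rewrite -subr_eq0 -normr_eq0; apply/eqP.
apply/le_anti; rewrite normr_ge0 andbT.
set K := (b - a) * (phi b - phi a).
have bound m : m.+1%:R * `|F b - F a| <= K.
  pose h := (b - a) / m.+1%:R; pose t k := a + k%:R * h.
  have h0 : 0 <= h by rewrite divr_ge0 // subr_ge0.
  have tm : t m.+1 = b by rewrite /t /h mulrC divfK // addrC subrK.
  have tS k : t k.+1 = t k + h by rewrite /t -natr1 mulrDl mul1r addrA.
  have step k : (k <= m.+1)%N -> `|F (t k) - F a| <= h * (phi (t k) - phi a).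
    elim: k => [|k IHk] km; first by rewrite /t mul0r addr0 !subrr normr0 mulr0.
    have -> : F (t k.+1) - F a = (F (t k.+1) - F (t k)) + (F (t k) - F a) by ring.
    apply: (le_trans (ler_normD _ _)).
    have -> : h * (phi (t k.+1) - phi a) =
      (t k.+1 - t k) * (phi (t k.+1) - phi (t k)) + h * (phi (t k) - phi a).
      by rewrite {2}tS; ring.
    apply: lerD; last exact: IHk (ltnW km).
    apply: incr; first by rewrite /t lerDl mulr_ge0.
      by rewrite tS lerDl.
    by rewrite -tm /t lerD2l ler_wpM2r // ler_nat.
  have := step m.+1 (leqnn _); rewrite tm /h => le_h.
  rewrite mulrC -ler_pdivlMr // (le_trans le_h) // /K.
  by rewrite mulrAC.
rewrite leNgt; apply/negP => F0.
have K0 : 0 <= K by rewrite (le_trans _ (bound 0)) // mul1r.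
have := archi_boundP (divr_ge0 K0 (ltW F0)); rewrite ltr_pdivrMr // ltNge.
apply/negP; rewrite negbK (le_trans _ (bound (Num.bound (K / `|F b - F a|)))) //.
by rewrite ler_wpM2r // ler_nat.
Qed.

(** The product rule in integrated form for a C^1 factor p and a factor x that
    is merely the indefinite integral of g. With F the difference of both
    sides, F t - F s is the integral over [s, t] of
    (p t - p r) * g r + p' r * (x s - x r), hence at most a constant times
    (t - s) * \int_s^t |g|. *)
Lemma Rintegral_product_rule (p p' x g : R -> R) a b : a <= b ->
  continuous p' -> (forall t : R, is_derive t 1 p (p' t)) ->
  mu.-integrable `[a, b] (EFin \o g) -> {within `[a, b], continuous x} ->
  (forall s t, a <= s -> s <= t -> t <= b ->
     x t = x s + \int[mu]_(r in `[s, t]) g r) ->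
  \int[mu]_(r in `[a, b]) (p' r * x r + p r * g r) = p b * x b - p a * x a.
Proof.
move=> ab cp' dp gi cx xE.
have cp : continuous p.
  move=> t; apply: differentiable_continuous; apply/derivable1_diffP.
  by have [] := dp t.
have [M M0 p'M] := segment_bounded (continuous_subspaceT (A := `[a, b]) cp').
pose h r := p' r * x r + p r * g r.
have hi : mu.-integrable `[a, b] (EFin \o h).
  have p'xi : mu.-integrable `[a, b] (EFin \o (fun r => p' r * x r)).
    apply: integrable_continuousM; first exact: continuous_subspaceT.
    exact: continuous_integrable.
  have pgi : mu.-integrable `[a, b] (EFin \o (fun r => p r * g r)).
    by apply: integrable_continuousM => //; exact: continuous_subspaceT.
  exact: integrable_add.
pose F t := p t * x t - \int[mu]_(r in `[a, t]) h r.
pose phi t := 2 * M * \int[mu]_(r in `[a, t]) `|g r|.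
have ngi : mu.-integrable `[a, b] (EFin \o (fun r => `|g r|)).
  exact: integrable_norm.
suff : F b = F a.
  rewrite /F set_itv1 Rintegral_set1 subr0 -/h => /eqP; rewrite subr_eq => /eqP ->.
  by rewrite addrAC subrr add0r.
apply: (product_bounded_increments_cst (phi := phi)) => // s t sa st tb.
have hsti : mu.-integrable `[s, t] (EFin \o h) by apply: integrable_subitv hi.
have gsti : mu.-integrable `[s, t] (EFin \o g) by apply: integrable_subitv gi.
have ngsti := integrable_norm gsti.
have hatE : \int[mu]_(r in `[a, t]) h r =
    \int[mu]_(r in `[a, s]) h r + \int[mu]_(r in `[s, t]) h r.
  by apply: Rintegral_chasles => //; apply: integrable_subitv hi.
have natE : \int[mu]_(r in `[a, t]) `|g r| =
    \int[mu]_(r in `[a, s]) `|g r| + \int[mu]_(r in `[s, t]) `|g r|.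
  by apply: Rintegral_chasles => //; apply: integrable_subitv ngi.
pose G := \int[mu]_(r in `[s, t]) `|g r|.
pose k r := 1 * (p t * g r + x s * p' r) + (-1) * h r.
have p'sti : mu.-integrable `[s, t] (EFin \o p').
  by apply: continuous_integrable; exact: continuous_subspaceT.
have li : mu.-integrable `[s, t] (EFin \o (fun r => p t * g r + x s * p' r)).
  exact: integrable_lincomb.
have FE : F t - F s = \int[mu]_(r in `[s, t]) k r.
  rewrite Rintegral_lincomb // Rintegral_lincomb //.
  rewrite (Rintegral_derivative st cp' dp) /F hatE (xE s t) //; ring.
have ki : mu.-integrable `[s, t] (EFin \o k) by exact: integrable_lincomb.
have cst_i : mu.-integrable `[s, t] (EFin \o cst (1 : R)).
  by apply: continuous_integrable; apply: continuous_subspaceT; exact: cst_continuous.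
rewrite FE (le_trans (le_normr_Rintegral _ _)) //.
have -> : (t - s) * (phi t - phi s) =
    M * (t - s) * G + M * G * \int[mu]_(r in `[s, t]) (cst 1 r : R).
  rewrite (Rintegral_derivative (F := id) st) /phi ?natE -/G; first by ring.
  exact: cst_continuous.
rewrite -Rintegral_lincomb //; apply: le_Rintegral => //.
- exact: integrable_norm.
- exact: integrable_lincomb.
move=> r; rewrite /= in_itv /= => /andP[sr rt].
have -> : k r = (p t - p r) * g r + p' r * (x s - x r) by rewrite /k /h; ring.
have p'rM c : s <= c -> c <= t -> `|p' c| <= M.
  by move=> sc ct; apply: p'M; rewrite (le_trans sa) // (le_trans ct).
rewrite (le_trans (ler_normD _ _)) // !normrM mulr1 lerD //.
- rewrite ler_wpM2r //.
  have [c crt ->] := MVT_segment rt (fun c _ => dp c) (continuous_subspaceT cp).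
  move: crt; rewrite in_itv /= => /andP[rc ct].
  rewrite normrM [`|t - r|]ger0_norm ?subr_ge0 //.
  by rewrite ler_pM ?subr_ge0 // ?p'rM ?(le_trans sr) // lerD2l lerN2.
- rewrite ler_pM ?p'rM // (xE s r) ?(le_trans rt) //.
  rewrite opprD addNKr normrN.
  have gsri : mu.-integrable `[s, r] (EFin \o g) by apply: integrable_subitv gsti.
  rewrite (le_trans (le_normr_Rintegral _ _)) // /G.
  rewrite [leRHS](@Rintegral_chasles _ _ r) // lerDl.
  by apply: Rintegral_ge0.
Qed.

End IntegralOnSegments.

(** * Real parts of complex exponentials *)

Section ExponentialModes.
Local Open Scope classical_set_scope.
Variable R : realType.
Implicit Types (c l : R[i]) (t a : R).

Lemma is_derive_cmul (f : R -> R) (a t d : R) :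
  is_derive t 1 f d -> is_derive t 1 (fun r => a * f r) (a * d).
Proof. exact: is_deriveZ. Qed.

Lemma is_derive_scale_comp (f : R -> R) (a t d : R) :
  is_derive (a * t) 1 f d -> is_derive t 1 (fun r => f (a * r)) (a * d).
Proof.
move=> df; rewrite mulrC; apply: (@is_derive1_comp _ f (fun r => a * r)).
by have := is_derive_cmul a (is_derive_id t 1); rewrite mulr1.
Qed.

Lemma is_derive_sumE n (h : 'I_n -> R -> R) (dh : 'I_n -> R) t :
  (forall i, is_derive t 1 (h i) (dh i)) ->
  is_derive t 1 (fun r => \sum_(i < n) h i r) (\sum_(i < n) dh i).
Proof.
move=> dhi; have := is_derive_sum dhi.
by congr (is_derive _ _ _ _); apply/funext => r; rewrite fct_sumE.
Qed.

Lemma is_derive_mul (f g : R -> R) (t df dg : R) :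
  is_derive t 1 f df -> is_derive t 1 g dg ->
  is_derive t 1 (fun r => f r * g r) (df * g t + f t * dg).
Proof.
move=> fd gd; have := is_deriveM fd gd.
by congr (is_derive _ _ _ _); rewrite addrC [g t *: _]mulrC.
Qed.

Lemma is_derive_continuous (f df : R -> R) :
  (forall t, is_derive t 1 f (df t)) -> continuous f.
Proof.
move=> fd t; apply: differentiable_continuous; apply/derivable1_diffP.
by have [] := fd t.
Qed.

(** The real part of c e^(l t). *)
Definition mode c l t : R :=
  expR (complex.Re l * t) * (complex.Re c * cos (complex.Im l * t)
                             - complex.Im c * sin (complex.Im l * t)).

Lemma mode0 c l : mode c l 0 = complex.Re c.
Proof. by rewrite /mode !mulr0 expR0 cos0 sin0 mulr0 subr0 mulr1 mul1r. Qed.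

Lemma modeD c c' l t : mode (c + c') l t = mode c l t + mode c' l t.
Proof. by case: c c' => [? ?] [? ?]; rewrite /mode /=; ring. Qed.

Lemma mode_cst0 l t : mode 0 l t = 0.
Proof. by rewrite /mode /= !mul0r subrr mulr0. Qed.

Lemma modeZ a c l t : mode (a%:C * c) l t = a * mode c l t.
Proof. by case: c => [? ?]; rewrite /mode /=; ring. Qed.

Lemma mode_sum n (c : 'I_n -> R[i]) l t :
  mode (\sum_(i < n) c i) l t = \sum_(i < n) mode (c i) l t.
Proof.
elim/big_rec2 : _ => [|i x y _ <-]; first exact: mode_cst0.
exact: modeD.
Qed.

Lemma is_derive_mode c l t : is_derive t 1 (mode c l) (mode (l * c) l t).
Proof.
case: c l => [p q] [a b].
have dE := is_derive_scale_comp (is_derive_expR (a * t)).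
have dC := is_derive_cmul p (is_derive_scale_comp (is_derive_cos (b * t))).
have dS := is_derive_cmul (- q) (is_derive_scale_comp (is_derive_sin (b * t))).
have := is_derive_mul dE (is_deriveD dC dS).
congr (is_derive _ _ _ _); rewrite /mode /= fctE; last by ring.
by apply/funext => r /=; rewrite mulNr.
Qed.

Lemma mode_cvg0 c l : 0 < complex.Re l -> mode c l t @[t --> -oo] --> (0 : R).
Proof.
case: c l => [p q] [a b] /= a0; pose K := `|p| + `|q|.
have expE : expR (a * t) @[t --> -oo] --> (0 : R).
  have -> : (fun t => expR (a * t)) = (fun t => expR (- t)) \o (fun t => - (a * t)).
    by apply/funext => t /=; rewrite opprK.
  apply: (@cvg_comp _ _ _ (fun t => - (a * t)) (fun t => expR (- t)) _ _ _ _ (@cvgr_expR R)).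
  apply/cvgryPge => A.
  near=> t; rewrite -mulrN mulrC -ler_pdivrMr // lerNr.
  by near: t; apply: nbhs_ninfty_le; rewrite num_real.
have KE s : s * expR (a * t) @[t --> -oo] --> (0 : R).
  by rewrite -(mulr0 s); apply: cvgMr.
apply: (squeeze_cvgr _ (KE (- K)) (KE K)).
near=> t; rewrite mulNr -ler_norml /mode /= normrM ger0_norm ?expR_ge0 // mulrC.
rewrite ler_wpM2r ?expR_ge0 // (le_trans (ler_normB _ _)) // !normrM /K.
by rewrite lerD // ler_piMr ?cos_max ?sin_max.
Unshelve. all: by end_near. Qed.

End ExponentialModes.

(** * Entrywise calculus of vector functions *)

Section MatrixCalculus.
Local Open Scope classical_set_scope.
Variables (R : realType) (n : nat).
Implicit Types (f g df dg : R -> 'cV[R]_n).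

Lemma dotmxC (u v : 'cV[R]_n) : (u^T *m v) 0 0 = (v^T *m u) 0 0.
Proof. by rewrite !mxE; apply: eq_bigr => j _; rewrite !mxE mulrC. Qed.

Lemma is_derive_mulmx m (M : 'M[R]_(m, n)) f (df : 'cV[R]_n) (t : R) :
  (forall i, is_derive t 1 (fun r => f r i 0) (df i 0)) ->
  forall i, is_derive t 1 (fun r => (M *m f r) i 0) ((M *m df) i 0).
Proof.
move=> fd i; rewrite mxE.
have -> : (fun r => (M *m f r) i 0) = (fun r => \sum_j M i j * f r j 0).
  by apply/funext => r; rewrite mxE.
by apply: is_derive_sumE => j; exact: is_derive_cmul.
Qed.

Lemma is_derive_dotmx f g (df dg : 'cV[R]_n) (t : R) :
  (forall i, is_derive t 1 (fun r => f r i 0) (df i 0)) ->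
  (forall i, is_derive t 1 (fun r => g r i 0) (dg i 0)) ->
  is_derive t 1 (fun r => ((f r)^T *m g r) 0 0)
    ((df^T *m g t) 0 0 + ((f t)^T *m dg) 0 0).
Proof.
move=> fd gd; rewrite [X in X + _]mxE [X in _ + X]mxE -big_split /=.
have -> : (fun r => ((f r)^T *m g r) 0 0) = (fun r => \sum_j f r j 0 * g r j 0).
  by apply/funext => r; rewrite mxE; apply: eq_bigr => j _; rewrite mxE.
by apply: is_derive_sumE => j; rewrite !mxE; exact: is_derive_mul.
Qed.

Section Limits.
Variables (F : set_system R) (FF : Filter F).

Lemma cvg_sum0 (I : Type) (r : seq I) (h : I -> R -> R) :
  (forall i, h i t @[t --> F] --> (0 : R)) ->
  \sum_(i <- r) h i t @[t --> F] --> (0 : R).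
Proof.
move=> h0; elim: r => [|i r IHr].
  by under eq_fun do rewrite big_nil; exact: cvg_cst.
under eq_fun do rewrite big_cons.
by have /(_ FF) := cvgD (h0 i) IHr; rewrite addr0.
Qed.

Lemma cvg_mulmx0 m (M : 'M[R]_(m, n)) f :
  (forall i, f t i 0 @[t --> F] --> (0 : R)) ->
  forall i, (M *m f t) i 0 @[t --> F] --> (0 : R).
Proof.
move=> f0 i; under eq_fun do rewrite mxE.
by apply: cvg_sum0 => j; rewrite -(mulr0 (M i j)); apply: cvgMr.
Qed.

Lemma cvg_dotmx0 f g :
  (forall i, f t i 0 @[t --> F] --> (0 : R)) ->
  (forall i, g t i 0 @[t --> F] --> (0 : R)) ->
  ((f t)^T *m g t) 0 0 @[t --> F] --> (0 : R).
Proof.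
move=> f0 g0; under eq_fun do rewrite mxE.
apply: cvg_sum0 => j; under eq_fun do rewrite mxE.
by rewrite -(mulr0 (0 : R)); apply: cvgM.
Qed.

End Limits.

Lemma Rintegral_sum (I : Type) (r : seq I) (h : I -> R -> R) (D : set R) :
  measurable D ->
  (forall i, (@lebesgue_measure R).-integrable D (EFin \o h i)) ->
  (@lebesgue_measure R).-integrable D (EFin \o (fun t => \sum_(i <- r) h i t)) /\
  \int[@lebesgue_measure R]_(t in D) (\sum_(i <- r) h i t) =
  \sum_(i <- r) \int[@lebesgue_measure R]_(t in D) h i t.
Proof.
move=> mD hi; elim: r => [|i r [IHi IHr]].
  split; last first.
    by under eq_Rintegral do rewrite big_nil; rewrite big_nil Rintegral_cst // mul0r.
  under [X in EFin \o X]eq_fun do rewrite big_nil.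
  exact: integrable0.
have sumE : (fun t => \sum_(j <- i :: r) h j t) =
    (fun t => 1 * h i t + 1 * \sum_(j <- r) h j t).
  by apply/funext => t; rewrite big_cons !mul1r.
rewrite sumE; split; first exact: integrable_lincomb.
by rewrite Rintegral_lincomb // big_cons IHr !mul1r.
Qed.

End MatrixCalculus.

(** * Optimality of the input given by the costate *)

Section MinimumEnergy.
Local Open Scope classical_set_scope.
Variables (R : realType) (n : nat) (A P : 'M[R]_n) (b x0 : 'cV[R]_n).
Variable p : R -> 'cV[R]_n.
Hypotheses (P_sym : P^T = P) (P_unit : P \in unitmx).
Hypothesis lyapunov : A *m P + P *m A^T = - (b *m b^T).
Hypothesis p_ode :
  forall (t : R) i, is_derive t 1 (fun r => p r i 0) ((- (A^T *m p t)) i 0).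
Hypothesis p_lim : forall i, p t i 0 @[t --> -oo] --> (0 : R).
Hypothesis p_0 : P *m p 0 = x0.
Local Notation mu := (@lebesgue_measure R).

(** The energy that [input] has spent up to time t, by [stored_derivative] and
    [stored_cvg0], is [stored] t. *)
Local Definition input t : R := (b^T *m p t) 0 0.
Local Definition state t : 'cV[R]_n := P *m p t.
Local Definition stored t : R := ((p t)^T *m state t) 0 0.
Local Notation Emin := ((x0^T *m invmx P *m x0) 0 0).

Lemma continuous_costate m (M : 'M[R]_(m, n)) i :
  continuous (fun t => (M *m p t) i 0).
Proof.
apply: is_derive_continuous => t.
exact: (is_derive_mulmx (df := - (A^T *m p t)) M (p_ode t)).
Qed.

Lemma continuous_input : continuous input.
Proof. exact: continuous_costate. Qed.

(** The Lyapunov equation turns the adjoint equation for p into the controlled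
    equation for P p. *)
Lemma state_velocity t :
  P *m (- (A^T *m p t)) = A *m state t + input t *: b.
Proof.
have /(congr1 (mulmx^~ (p t))) := lyapunov.
rewrite mulmxDl -!mulmxA mulNmx -mulmxA [X in b *m X]mx11_scalar mul_mx_scalar.
rewrite -/(input t) -/(state t) mulmxN => lyap_p.
by rewrite -[input t *: b]opprK -lyap_p opprD addrA subrr add0r.
Qed.

Lemma state_ode (t : R) i : is_derive t 1 (fun r => state r i 0)
  ((A *m state t + input t *: b) i 0).
Proof. by rewrite -state_velocity; exact: is_derive_mulmx. Qed.

Lemma costate_velocityT t : (- (A^T *m p t))^T = - ((p t)^T *m A).
Proof. by rewrite linearN /= trmx_mul trmxK. Qed.

Lemma stored_derivative (t : R) : is_derive t 1 stored (input t ^+ 2).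
Proof.
have := is_derive_dotmx (p_ode t) (state_ode t).
congr (is_derive _ _ _ _).
rewrite costate_velocityT mulNmx mulmxDr -(scalemxAr (input t)) -!mulmxA.
rewrite [X in _ + X]mxE [X in X + _]mxE addKr mxE expr2.
by rewrite dotmxC.
Qed.

Lemma stored_0 : stored 0 = Emin.
Proof.
rewrite /stored /state -p_0 trmx_mul P_sym; congr ((_ *m _) 0 0).
by rewrite -mulmxA mulmxV // mulmx1.
Qed.

Lemma state_cvg0 i : state t i 0 @[t --> -oo] --> (0 : R).
Proof. exact: cvg_mulmx0. Qed.

Lemma stored_cvg0 : stored t @[t --> -oo] --> (0 : R).
Proof. by apply: cvg_dotmx0 => // i; exact: state_cvg0. Qed.

Lemma input_steers : steers A b input x0.
Proof.
exists state; split=> //; last exact: state_cvg0.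
have vel_cont i : continuous (fun r => (A *m state r + input r *: b) i 0).
  under [X in continuous X]eq_fun do rewrite -state_velocity mulmxN mulmxA -mulNmx.
  exact: continuous_costate.
split.
- move=> s s0; apply: continuous_integrable; apply: continuous_subspaceT.
  exact: continuous_input.
- move=> i; apply: continuous_subspaceT; exact: continuous_costate.
- move=> s t i st t0.
  rewrite (Rintegral_derivative st (vel_cont i) (state_ode ^~ i)).
  by rewrite addrC subrK.
Qed.

Lemma input_energy : energy input = Emin%:E.
Proof.
have csq : continuous (fun t => input t ^+ 2).
  under [X in continuous X]eq_fun do rewrite expr2.
  by move=> t; apply: cvgM; exact: continuous_input.
have csqN : continuous ((fun t => input t ^+ 2) \o -%R).
  move=> t; apply: continuous_comp; first exact: opp_continuous.
  exact: csq.
have dF (t : R) : is_derive t 1 (fun r => - stored (- r)) (input (- t) ^+ 2).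
  have := is_deriveN (is_derive1_comp (stored_derivative (- t)) (is_deriveNid t 1)).
  by rewrite mulrN1 opprK.
have cF := is_derive_continuous dF.
rewrite /energy -[X in `]-oo, X]]oppr0 ge0_integration_by_substitutionNy; last 2 first.
- exact: continuous_subspaceT.
- by move=> t _; exact: sqr_ge0.
rewrite (@ge0_continuous_FTC2y _ _ (fun r => - stored (- r)) _ 0) //.
- by rewrite -EFinB sub0r opprK oppr0 stored_0.
- by move=> t _; exact: sqr_ge0.
- exact: continuous_subspaceT.
- rewrite -(oppr0 R); apply: cvgN.
  exact: (cvgNy_compNP stored _).1 stored_cvg0.
- by apply: cvg_at_right_filter; exact: cF.
- by move=> t _; rewrite derive1E; have [_ ->] := dF t.
Qed.

(** The drift terms of p^T x cancel, because p follows the adjoint equation. *)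
Lemma input_pairing (u : R -> R) (x : R -> 'cV[R]_n) (s : R) : s <= 0 ->
  trajectory A b u x ->
  \int[mu]_(r in `[s, 0]) (input r * u r) =
  ((p 0)^T *m x 0) 0 0 - ((p s)^T *m x s) 0 0.
Proof.
move=> s0 [ui xc xE].
pose g r i := (A *m x r + u r *: b) i 0.
have xcs i : {within `[s, 0], continuous (fun t => x t i 0)}.
  apply: continuous_subspaceW (xc i) => t /=; rewrite !in_itv /=.
  by case/andP.
have gi i : mu.-integrable `[s, 0] (EFin \o (fun r => g r i)).
  have -> : (fun r => g r i) =
      (fun r => 1 * (\sum_j A i j * x r j 0) + b i 0 * u r).
    by apply/funext => r; rewrite /g !mxE mul1r mulrC.
  apply: integrable_lincomb; [by []| |exact: ui].
  apply: (Rintegral_sum _ _ _).1 => // j.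
  apply: continuous_integrable => t.
  by apply: cvgMr; exact: xcs.
pose h i r := (- (A^T *m p r)) i 0 * x r i 0 + p r i 0 * g r i.
have cp' i : continuous (fun t => (- (A^T *m p t)) i 0).
  under [X in continuous X]eq_fun do rewrite -mulNmx.
  exact: continuous_costate.
have hE i : \int[mu]_(r in `[s, 0]) h i r = p 0 i 0 * x 0 i 0 - p s i 0 * x s i 0.
  apply: Rintegral_product_rule => //.
  by move=> r t sr rt t0; exact: xE.
have hi i : mu.-integrable `[s, 0] (EFin \o h i).
  apply: integrable_add => //; apply: integrable_continuousM => //;
    try exact: continuous_subspaceT.
    exact: continuous_integrable.
  apply: continuous_subspaceT; exact: is_derive_continuous (p_ode ^~ i).
transitivity (\int[mu]_(r in `[s, 0]) \sum_i h i r).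
  apply: eq_Rintegral => r _.
  transitivity (((- (A^T *m p r))^T *m x r) 0 0
                + ((p r)^T *m (A *m x r + u r *: b)) 0 0).
    rewrite costate_velocityT mulNmx mulmxDr -(scalemxAr (u r)) -mulmxA.
    by rewrite [X in _ + X]mxE [X in X + _]mxE addKr mxE dotmxC mulrC.
  rewrite [X in X + _]mxE [X in _ + X]mxE -big_split /=; apply: eq_bigr => j _.
  by rewrite [X in X * _]mxE [X in _ + X * _]mxE.
rewrite (Rintegral_sum _ _ _).2 //.
rewrite (eq_bigr _ (fun i _ => hE i)) sumrB !mxE.
by congr (_ - _); apply: eq_bigr => i _; rewrite mxE.
Qed.

Lemma costate_endpoint : ((p 0)^T *m x0) 0 0 = Emin.
Proof. by rewrite -stored_0 /stored /state p_0. Qed.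

(** An input of finite energy is square integrable on segments; its
    measurability on the half-line comes from that on the segments [- k, 0]. *)
Lemma energy_restrict (u : R -> R) (s r : R) : s <= 0 ->
  (forall s, s <= 0 -> mu.-integrable `[s, 0] (EFin \o u)) ->
  energy u = r%:E ->
  mu.-integrable `[s, 0] (EFin \o (fun t => u t ^+ 2)) /\
  \int[mu]_(t in `[s, 0]) (u t ^+ 2) <= r.
Proof.
move=> s0 ui ur.
have mu_sq (t : R) : t <= 0 ->
    measurable_fun `[t, 0] (fun q => u q ^+ 2).
  move=> t0; apply: measurable_funX; apply/measurable_EFinP.
  exact: measurable_int (ui _ t0).
have msq : measurable_fun (`]-oo, (0 : R)] : set R) (fun q => u q ^+ 2).
  rewrite itvNy_bnd_bigcup_BLeft; apply/measurable_fun_bigcup => // k.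
  by apply: mu_sq; rewrite sub0r oppr_le0.
have le_r : (\int[mu]_(t in `[s, 0%R]) (u t ^+ 2)%:E <= r%:E)%E.
  rewrite -ur; apply: ge0_subset_integral => //.
  - exact/measurable_EFinP.
  - by move=> t _; rewrite lee_fin sqr_ge0.
  - by apply: subset_itvr; rewrite bnd_simp.
have int0 : (0 <= \int[mu]_(t in `[s, 0%R]) (u t ^+ 2)%:E)%E.
  by apply: integral_ge0 => t _; rewrite lee_fin sqr_ge0.
split; last first.
  rewrite /Rintegral -lee_fin fineK // fin_real // (le_lt_trans le_r) ?ltry //.
  by rewrite (lt_le_trans _ int0) // ltNyr.
apply/integrableP; split; first by apply/measurable_EFinP; exact: mu_sq.
under eq_integral do rewrite /= ger0_norm ?sqr_ge0 //.
exact: le_lt_trans le_r (ltry _).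
Qed.

(** Pointwise u^2 >= 2 (input u) - input^2, and the integrals of both terms on
    the right are boundary terms, whose contributions at s vanish as s tends
    to - oo. *)
Lemma input_minimal (u : R -> R) : steers A b u x0 -> (Emin%:E <= energy u)%E.
Proof.
case=> x [traj xlim x0E]; have [ui xc xE] := traj.
case ur : (energy u) => [r| |]; last 2 first.
- by rewrite leey.
- have : (0 <= energy u)%E by apply: integral_ge0 => t _; rewrite lee_fin sqr_ge0.
  by rewrite ur.
rewrite lee_fin.
pose f s := Emin - (2 * ((p s)^T *m x s) 0 0 - stored s).
have fE : f s @[s --> -oo] --> Emin.
  rewrite -[X in _ --> X]subr0; apply: cvgB; first exact: cvg_cst.
  rewrite -[X in _ --> X](subrr 0); apply: cvgB; last exact: stored_cvg0.
  by rewrite -(mulr0 2); apply: cvgMr; exact: cvg_dotmx0.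
apply: (cvgr_to_le fE); near=> s.
have s0 : s <= 0 by near: s; apply: nbhs_ninfty_le; rewrite num_real.
have [usqi usq_le] := energy_restrict s0 ui ur; apply: le_trans usq_le.
have cin := continuous_subspaceT (A := `[s, 0]) continuous_input.
have ini := integrable_continuousM cin (continuous_integrable cin).
have inui := integrable_continuousM cin (ui _ s0).
have -> : f s = \int[mu]_(t in `[s, 0])
    (2 * (input t * u t) + (-1) * (input t * input t)).
  rewrite Rintegral_lincomb // (input_pairing s0 traj) x0E costate_endpoint.
  have -> : \int[mu]_(t in `[s, 0]) (input t * input t) = stored 0 - stored s.
    apply: Rintegral_derivative => //.
      by move=> t; apply: cvgM; exact: continuous_input.
    by move=> t; rewrite -expr2; exact: stored_derivative.
  by rewrite stored_0 /f; ring.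
apply: le_Rintegral => //; first exact: integrable_lincomb.
by move=> t _; rewrite -subr_ge0 (_ : _ - _ = (u t - input t) ^+ 2) ?sqr_ge0 //; ring.
Unshelve. all: by end_near. Qed.

Lemma costate_min_energy : is_min_energy A b x0 Emin.
Proof.
split; last exact: input_minimal.
by exists input; [exact: input_steers|exact: input_energy].
Qed.

End MinimumEnergy.

(** * Eigenvectors of the companion matrix *)

Section CompanionEigenvectors.
Variables (R : realType) (N : {poly R}).
Hypotheses (Nmonic : N \is monic) (Nsize : (1 < size N)%N).
Local Notation n := (size N).-1.
Local Notation C := R[i].
Local Notation A := (toC (companionmx N) : 'M[C]_n).
Local Notation e := (toC (e_last N) : 'cV[C]_n).
Local Notation NC := (NC N).

Lemma coefNC k : NC`_k = (N`_k)%:C.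
Proof. by rewrite coef_map. Qed.

Lemma size_NC : size NC = n.+1.
Proof. by rewrite size_map_poly prednK // ltnW. Qed.

Lemma n_gt0 : (0 < n)%N.
Proof. by case: (size N) Nsize => [|[]]. Qed.

Lemma NC_horner l : NC.[l] = \sum_(k < n) NC`_k * l ^+ k + l ^+ n.
Proof.
rewrite horner_coef size_NC big_ord_recr /=; congr (_ + _).
by rewrite coefNC (_ : N`_n = 1) ?mul1r //; apply/eqP.
Qed.

Lemma right_evE l k : right_ev N l k 0 = l ^+ k.
Proof. by rewrite mxE. Qed.

Lemma residueE l : residue N l =
  (- NC^`().[l])^-1 *: (right_ev N l *m (left_ev N l)^T).
Proof. by []. Qed.

Lemma right_evN l : right_ev N (- l) = - (sign_mx N *m right_ev N l).
Proof.
apply/colP => k; rewrite !mxE (bigD1 k) //= big1 => [|j jk]; last first.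
  by rewrite !mxE eq_sym (negbTE jk) mulr0n mul0r.
by rewrite !mxE eqxx mulr1n addr0 (exprNn l) exprS !mulN1r mulNr opprK.
Qed.

(** The companion matrix shifts the vector of powers; only the last row sees
    the coefficients of N, so the defect is carried by the last basis vector. *)
Lemma companion_right_ev l :
  A *m right_ev N l = l *: right_ev N l - NC.[l] *: e.
Proof.
apply/colP => i; rewrite !mxE.
have [ilast|inlast] := eqVneq (i : nat) n.-1.
  have iS : i.+1 = n by have := n_gt0; lia.
  rewrite {1}iS eqxx rmorph1 mulr1 -exprS iS.
  rewrite NC_horner opprD addrCA subrr addr0 -sumrN; apply: eq_bigr => j _.
  by rewrite !mxE ilast eqxx coefNC rmorphN mulNr.
have ltin : (i.+1 < n)%N.
  by have := ltn_ord i; move/eqP: inlast; lia.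
rewrite (ltn_eqF ltin) mulr0 subr0 (bigD1 (Ordinal ltin)) //= big1.
  by rewrite !mxE (negbTE inlast) eqxx mul1r addr0 exprS.
move=> j jS; rewrite !mxE (negbTE inlast) (_ : (i.+1 == j) = false) ?mul0r //.
by apply: contraNF jS => /eqP ij; apply/eqP/val_inj.
Qed.

(** Synthetic division of N by l: when l is a root, [synth l k.+1] is the
    coefficient of X^k in N(X) / (l - X). *)
Definition synth (l : C) k : C := l ^- k * \sum_(j < k) NC`_j * l ^+ j.

Lemma synthS l k : l != 0 -> l * synth l k.+1 = synth l k + NC`_k.
Proof.
move=> l0; rewrite /synth big_ord_recr /= exprS invfM -mulrA mulVKf //.
by rewrite mulrDr mulrCA mulVf ?expf_neq0 // mulr1.
Qed.

Lemma synth_last l : l != 0 -> root NC l -> synth l n = -1.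
Proof.
move=> l0 /rootP; rewrite NC_horner => /eqP.
by rewrite addr_eq0 /synth => /eqP ->; rewrite mulrN mulVf ?expf_neq0.
Qed.

Lemma left_evE l (i : 'I_n) : l != 0 -> left_ev N l i 0 = synth l i.+1.
Proof.
move=> l0; rewrite !mxE /synth.
pose F k := if (k < i.+1)%N then NC`_(i - k) * l ^+ (n - k.+1) else 0.
transitivity (l ^- n * \sum_(k < n) F k).
  congr (_ * _); rewrite [RHS](reindex_inj rev_ord_inj) /=.
  apply: eq_bigr => k _; rewrite !mxE /F.
  have kn := ltn_ord k; have i_n := ltn_ord i.
  have -> : (n - k.+1 < i.+1)%N = (n <= i + k + 1)%N by lia.
  case: ifP => h; last by rewrite mul0r.
  by rewrite subnBA // subnSK // subKn ?addn1 ?addnS ?coefNC // ltnW.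
rewrite -big_mkcond /=.
rewrite -(big_ord_widen n (fun k => NC`_(i - k) * l ^+ (n - k.+1))) //.
rewrite [in LHS](reindex_inj rev_ord_inj) /= !mulr_sumr.
apply: eq_bigr => k _; rewrite mulrCA [RHS]mulrCA.
have ki := ltn_ord k; have i_n := ltn_ord i.
rewrite subSS subKn //.
congr (_ * _); apply: (canLR (mulKf _)); first by rewrite expf_neq0.
rewrite mulrCA; apply: (canRL (mulKf _)); first by rewrite expf_neq0.
have idx a b c : (a < b -> c < a.+1 -> a.+1 + (b - (a - c).+1) = b + c)%N by lia.
by rewrite -!exprD idx.
Qed.

Section Root.
Variable l : C.
Hypotheses (l0 : l != 0) (Nl : root NC l).
Local Notation y := (left_ev N l).
Local Notation Y := (\poly_(k < n) synth l k.+1).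

(** The entries of y are the coefficients of N(X) / (l - X): evaluating this
    identity and its derivative gives every product y^T x_m. *)
Lemma poly_left_ev : (l%:P - 'X) * Y = NC.
Proof.
apply/polyP => k; rewrite mulrBl coefB coefCM [ 'X * _]mulrC coefMX !(coef_poly n).
have [kn|] := ltnP k n.
  rewrite synthS //; case: k kn => [|k] kn /=; last first.
    by rewrite (ltnW kn) addrAC subrr add0r.
  by rewrite /synth big_ord0 mulr0 subr0 add0r.
rewrite mulr0 sub0r leq_eqVlt => /predU1P[<-|nk].
  rewrite (negbTE (lt0n_neq0 n_gt0)) (prednK n_gt0) leqnn.
  by rewrite synth_last // opprK coefNC -/(lead_coef N) (eqP Nmonic).
rewrite (_ : (k.-1 < n)%N = false); last by lia.
by rewrite if_same oppr0 nth_default // size_NC.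
Qed.

Lemma left_right_ev m : (y^T *m right_ev N m) 0 0 = Y.[m].
Proof.
rewrite mxE horner_poly; apply: eq_bigr => k _.
by rewrite !mxE -left_evE // !mxE.
Qed.

Lemma left_right_ev_neq m : (l - m) * (y^T *m right_ev N m) 0 0 = NC.[m].
Proof. by rewrite left_right_ev -poly_left_ev !hornerE. Qed.

Lemma left_right_ev_eq : (y^T *m right_ev N l) 0 0 = - NC^`().[l].
Proof.
rewrite left_right_ev -poly_left_ev derivM derivB derivC derivX sub0r mulN1r.
by rewrite hornerD hornerM hornerN hornerD hornerN hornerC hornerX subrr mul0r addr0 opprK.
Qed.

Lemma left_ev_last : (y^T *m e) 0 0 = -1.
Proof.
have n1 : (n.-1 < n)%N by rewrite (prednK n_gt0).
rewrite mxE (bigD1 (Ordinal n1)) //= big1 => [|j /eqP/val_eqP/= jn].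
  rewrite addr0 mxE left_evE //= (prednK n_gt0) synth_last //.
  by rewrite 2!mxE /= (prednK n_gt0) eqxx rmorph1 mulr1.
rewrite [X in _ * X]mxE [X in real_complex _ X]mxE.
by rewrite -[X in _ == X](prednK n_gt0) eqSS (negbTE jn) rmorph0 mulr0.
Qed.

Lemma companion_left_ev : A^T *m y = l *: y.
Proof.
apply/colP => j; rewrite [RHS]mxE left_evE // synthS //.
have n1 : (n.-1 < n)%N by rewrite (prednK n_gt0).
rewrite mxE (bigD1 (Ordinal n1)) //= left_evE //= (prednK n_gt0) synth_last //.
rewrite 3!mxE eqxx rmorphN mulrN1 opprK coefNC addrC; congr (_ + _).
have [j0|j0] := posnP j.
  rewrite j0 /synth big_ord0 mulr0 big1 // => i /eqP/val_eqP/= /negbTE il.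
  by rewrite !mxE j0 il mul0r.
have j1 : (j.-1 < n)%N by rewrite (leq_ltn_trans (leq_pred j)).
rewrite (bigD1 (Ordinal j1)) /=; last first.
  by rewrite -val_eqE /= -eqSS !prednK ?n_gt0 // ltn_eqF.
rewrite big1 ?addr0 => [|i /andP[/eqP/val_eqP/= /negbTE il /eqP/val_eqP/= ij]].
  rewrite left_evE //= 3!mxE -eqSS !prednK ?n_gt0 // (ltn_eqF (ltn_ord j)).
  by rewrite eqxx mul1r.
by rewrite !mxE il -(prednK j0) eqSS (negbTE ij) mul0r.
Qed.

End Root.

(** * Biorthogonality and spectral decomposition *)

Section Spectrum.
Variables (lambda : 'I_n -> C).
Hypotheses (lambda_inj : injective lambda).
Hypotheses (lambda_root : forall i, root NC (lambda i)).
Hypotheses (lambda_stable : forall i, 'Re (lambda i) < 0).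

Local Notation x i := (right_ev N (lambda i)).
Local Notation y i := (left_ev N (lambda i)).
Local Notation N' i := (NC^`().[lambda i]).

Lemma lambda_neq0 i : lambda i != 0.
Proof.
by apply: contraTneq (lambda_stable i) => ->; rewrite raddf0 ltxx.
Qed.

Lemma lambdaD_neq0 i j : lambda i + lambda j != 0.
Proof.
apply: contraTneq (ltrD (lambda_stable i) (lambda_stable j)) => ij.
by rewrite -raddfD ij raddf0 addr0 ltxx.
Qed.

Lemma left_right_lambda i j :
  ((y i)^T *m x j) 0 0 = - N' i * (i == j)%:R.
Proof.
have [->|ij] := eqVneq i j.
  by rewrite mulr1 left_right_ev_eq // lambda_neq0.
have := left_right_ev_neq (lambda_neq0 i) (lambda_root i) (lambda j).
move/eqP: (lambda_root j) => /= ->.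
move/eqP; rewrite mulf_eq0 subr_eq0 (inj_eq lambda_inj) (negbTE ij) /= => /eqP ->.
by rewrite mulr0.
Qed.

Lemma Vandermonde_unit (a : 'rV[C]_n) :
  injective (a 0) -> Vandermonde n a \in unitmx.
Proof.
move=> a_inj; rewrite unitmxE det_Vandermonde unitfE.
apply/prodf_neq0 => i _; apply/prodf_neq0 => j ij.
by rewrite subr_eq0 (inj_eq a_inj); apply: contraTneq ij => ->; rewrite ltnn.
Qed.

(** A double root would make y_i orthogonal to every x_j, hence zero, the x_j
    being the columns of an invertible Vandermonde matrix; but the last entry
    of y_i is -1. *)
Lemma deriv_lambda_neq0 i : N' i != 0.
Proof.
apply/eqP => N'0.
have V_unit : Vandermonde n (\row_j lambda j) \in unitmx.
  by apply: Vandermonde_unit => j k; rewrite !mxE => /lambda_inj.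
have yV0 : (y i)^T *m Vandermonde n (\row_j lambda j) = 0.
  apply/rowP => j; rewrite [RHS]mxE.
  have := left_right_lambda i j; rewrite N'0 oppr0 mul0r mxE => <-.
  by rewrite mxE; apply: eq_bigr => k _; rewrite !mxE.
have := left_ev_last (lambda_neq0 i) (lambda_root i).
rewrite -[(y i)^T](mulmxK V_unit) yV0 !mul0mx mxE => /eqP.
by rewrite eq_sym oppr_eq0 oner_eq0.
Qed.

(** Biorthogonality says that the scaled rows y_i^T form a left inverse of the
    square matrix with columns x_i, hence also a right inverse. *)
Lemma sum_residue : \sum_i residue N (lambda i) = 1%:M.
Proof.
pose X : 'M[C]_n := \matrix_(k, i) x i k 0.
pose W : 'M[C]_n := \matrix_(i, k) ((- N' i)^-1 * y i k 0).
have WX : W *m X = 1%:M.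
  apply/matrixP => i j; rewrite [RHS]mxE.
  rewrite -[RHS](mulKf (_ : - N' i != 0)) ?oppr_eq0 ?deriv_lambda_neq0 //.
  rewrite -left_right_lambda !mxE mulr_sumr; apply: eq_bigr => k _.
  by rewrite [W _ _]mxE [X _ _]mxE [_^T _ _]mxE mulrA.
rewrite -(mulmx1C WX); apply/matrixP => k l; rewrite summxE [RHS]mxE.
apply: eq_bigr => i _; rewrite [W _ _]mxE [X _ _]mxE [LHS]mxE.
by rewrite mxE big_ord1 [_^T _ _]mxE mulrCA.
Qed.

Lemma left_ev_separate (w : 'cV[C]_n) :
  (forall i, ((y i)^T *m w) 0 0 = 0) -> w = 0.
Proof.
move=> yw0; rewrite -[w]mul1mx -sum_residue mulmx_suml big1 // => i _.
rewrite /residue -scalemxAl -mulmxA [X in _ *m X]mx11_scalar yw0.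
by rewrite raddf0 mulmx0 scaler0.
Qed.

(** The y_i separate vectors, so the pairings y_i^T M y_j determine M; symmetry
    of P is read off from them. *)
Lemma left_ev_form_inj (M : 'M[C]_n) :
  (forall i j, ((y i)^T *m M *m y j) 0 0 = 0) -> M = 0.
Proof.
move=> M0; have My j : M *m y j = 0.
  by apply: left_ev_separate => i; rewrite mulmxA M0.
apply: trmx_inj; rewrite trmx0; apply/matrixP => i j; rewrite [RHS]mxE.
suff : M^T *m delta_mx j 0 = (0 : 'cV_n).
  by move/colP/(_ i); rewrite -colE !mxE.
apply: left_ev_separate => k.
by rewrite mulmxA -trmx_mul My trmx0 mul0mx mxE.
Qed.

(** - lambda_j is not an eigenvalue, by stability. *)
Lemma companion_shift_inj j (w : 'cV[C]_n) :
  A *m w = - lambda j *: w -> w = 0.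
Proof.
move=> Aw; apply: left_ev_separate => i; apply/eqP.
have yA : (y i)^T *m A = lambda i *: (y i)^T.
  rewrite -[A]trmxK -trmx_mul companion_left_ev ?lambda_neq0 //.
  by apply/matrixP => r k; rewrite !mxE.
have : (y i)^T *m A *m w = (y i)^T *m (A *m w) by rewrite mulmxA.
rewrite yA Aw -scalemxAl -scalemxAr => /matrixP/(_ 0 0)/eqP.
rewrite [X in X == _]mxE [X in _ == X]mxE -subr_eq0 -mulrBl opprK mulf_eq0.
by rewrite (negbTE (lambdaD_neq0 i j)).
Qed.

Lemma NC_opp_lambda_neq0 j : NC.[- lambda j] != 0.
Proof.
apply/eqP => N0; have := companion_right_ev (- lambda j).
rewrite N0 scale0r subr0 => /companion_shift_inj/colP/(_ (Ordinal n_gt0))/eqP.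
by rewrite !mxE expr0 oner_eq0.
Qed.

(** * The Lyapunov equation *)

Section Gramian.
Variable P : 'M[R]_n.
Hypothesis lyapunov : companionmx N *m P + P *m (companionmx N)^T =
  - (e_last N *m (e_last N)^T).
Local Notation PC := (toC P).

Lemma lyapunovC : A *m PC + PC *m A^T = - (e *m e^T).
Proof. by rewrite !map_trmx -!map_mxM -map_mxD lyapunov map_mxN map_mxM. Qed.

(** Multiplying the Lyapunov equation by y_j and subtracting a multiple of the
    defect equation of [companion_right_ev] at - lambda_j leaves a vector in
    the kernel of A + lambda_j. *)
Lemma gramian_left_ev j :
  PC *m y j = - (NC.[- lambda j])^-1 *: right_ev N (- lambda j).
Proof.
have N0 := NC_opp_lambda_neq0 j.
apply/eqP; rewrite -subr_eq0; apply/eqP; apply: (@companion_shift_inj j).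
have APy : A *m (PC *m y j) = - lambda j *: (PC *m y j) + e.
  have /(congr1 (mulmx^~ (y j))) := lyapunovC.
  rewrite mulmxDl -!mulmxA companion_left_ev ?lambda_neq0 // -(scalemxAr (lambda j)).
  move/(canRL (addrK _)) => ->; rewrite scaleNr addrC; congr (_ + _).
  rewrite mulNmx -mulmxA -[X in _ *m X]trmxK trmx_mul trmxK.
  rewrite [X in _ *m X^T]mx11_scalar left_ev_last ?lambda_neq0 //.
  by rewrite tr_scalar_mx mul_mx_scalar scaleN1r opprK.
set c := - (NC.[- lambda j])^-1; have cN : c * NC.[- lambda j] = -1.
  by rewrite mulNr mulVf.
rewrite mulmxBr APy -(scalemxAr c) companion_right_ev !scalerBr !scalerA cN.
move: (PC *m y j) (right_ev N _) => w v.
by rewrite scaleN1r opprK [c * _]mulrC opprD addrACA subrr addr0.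
Qed.

Lemma gramian_form i j :
  ((y i)^T *m PC *m y j) 0 0 = - (lambda i + lambda j)^-1.
Proof.
rewrite -mulmxA gramian_left_ev -(scalemxAr (- _)) mxE.
have := left_right_ev_neq (lambda_neq0 i) (lambda_root i) (- lambda j).
rewrite opprK => /(canRL (mulKf (lambdaD_neq0 i j))) ->.
by rewrite mulNr mulrCA mulVf ?mulr1 // NC_opp_lambda_neq0.
Qed.

Lemma form_trmx (M : 'M[C]_n) (u v : 'cV[C]_n) :
  (u^T *m M^T *m v) 0 0 = (v^T *m M *m u) 0 0.
Proof.
transitivity ((v^T *m M *m u)^T 0 0); last by rewrite mxE.
by rewrite !trmx_mul trmxK mulmxA.
Qed.

Lemma gramian_sym : P^T = P.
Proof.
apply: (map_mx_inj (f := real_complex R)); apply/eqP; rewrite -subr_eq0.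
apply/eqP/left_ev_form_inj => i j; rewrite mulmxBr mulmxBl mxE [X in _ + X]mxE.
rewrite -map_trmx.
rewrite (gramian_form i j) (form_trmx PC (y i)) (gramian_form j i).
by rewrite [lambda j + _]addrC opprK addNr.
Qed.

(** P maps the multiples - N(- lambda_j) y_j to the columns of an invertible
    Vandermonde matrix. *)
Lemma gramian_unit : P \in unitmx.
Proof.
rewrite -(map_unitmx (real_complex R)).
pose V := Vandermonde n (\row_j - lambda j).
have V_unit : V \in unitmx.
  by apply: Vandermonde_unit => j k; rewrite !mxE => /oppr_inj/lambda_inj.
suff PYV : PC *m \matrix_(k, j) (- NC.[- lambda j] * y j k 0) = V.
  by move: V_unit; rewrite -PYV unitmx_mul => /andP[].
apply/matrixP => k j; have /colP/(_ k) := gramian_left_ev j.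
rewrite [RHS]mxE right_evE => /(congr1 (fun z => - NC.[- lambda j] * z)).
rewrite mulrA mulrNN mulfV ?NC_opp_lambda_neq0 // mul1r => Vkj.
rewrite [RHS]mxE [X in X ^+ _]mxE -Vkj !mxE mulr_sumr; apply: eq_bigr => l _.
by rewrite [X in _ * X]mxE mulrCA.
Qed.

(** Away from the last row and column the Lyapunov equation only shifts the
    indices of P. *)
Lemma gramian_shift (i i' j j' : 'I_n) :
  i' = i.+1 :> nat -> j' = j.+1 :> nat -> P i' j = - P i j'.
Proof.
have shiftE (k k' l : 'I_n) (M : 'M[R]_n) : k' = k.+1 :> nat ->
    (companionmx N *m M) k l = M k' l.
  move=> kk'; have kn : (k == n.-1 :> nat) = false.
    by have := ltn_ord k'; rewrite kk'; case: eqP => // ->; rewrite (prednK n_gt0) ltnn.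
  rewrite mxE (bigD1 k') //= big1 ?addr0 => [|r /eqP/val_eqP/= rk].
    by rewrite mxE kn kk' eqxx mul1r.
  by rewrite mxE kn -kk' eq_sym (negbTE rk) mul0r.
move=> ii' jj'; have /matrixP/(_ i j) := lyapunov.
rewrite mxE (shiftE _ i') // -[P *m _]trmxK trmx_mul trmxK [X in _ + X]mxE.
rewrite (shiftE _ j') // !mxE big_ord1 !mxE -ii' ltn_eqF ?ltn_ord // mul0r.
by rewrite oppr0 => /eqP; rewrite addr_eq0 => /eqP.
Qed.

Lemma gramian_antidiag k (i i' j j' : 'I_n) :
  i' = (i + k)%N :> nat -> j' = (j + k)%N :> nat ->
  P i' j = (-1) ^+ k * P i j'.
Proof.
elim: k i' j => [|k IHk] i' j; rewrite ?addn0 ?addnS => ii' jj'.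
  by rewrite mul1r; congr (P _ _); apply: val_inj.
have i1 : (i + k < n)%N by rewrite ltnW // -ii' ltn_ord.
have j1 : (j.+1 < n)%N by rewrite (leq_ltn_trans _ (ltn_ord j')) // jj' ltnS leq_addr.
rewrite (@gramian_shift (Ordinal i1) _ _ (Ordinal j1)) // IHk //.
by rewrite exprS mulN1r mulNr.
Qed.

(** When i + j is odd, moving along the antidiagonal from (i, j) to (j, i)
    changes the sign, while symmetry does not. *)
Lemma gramian_checkerboard (i j : 'I_n) : odd (i + j) -> P i j = 0.
Proof.
wlog ij : i j / (i <= j)%N => [th|].
  by have [/th//|/ltnW/th h] := leqP i j; rewrite addnC -gramian_sym mxE => /h.
move=> odd_ij; have := @gramian_antidiag (j - i) i j i j.
rewrite !subnKC // -[in P j i]gramian_sym mxE => /(_ erefl erefl).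
rewrite -signr_odd oddB // addbC -oddD odd_ij mulN1r => /eqP.
by rewrite -addr_eq0 -mulr2n mulrn_eq0 => /eqP.
Qed.

Lemma sign_gramian : sign_mx N *m PC = PC *m sign_mx N.
Proof.
apply/matrixP => i j; rewrite mul_diag_mx mul_mx_diag !mxE.
have [/gramian_checkerboard ->|even_ij] := boolP (odd (i + j)).
  by rewrite rmorph0 mulr0 mul0r.
rewrite mulrC -(signr_odd _ i.+1) -(signr_odd _ j.+1) /=.
by move: even_ij; rewrite oddD; do 2!case: odd.
Qed.

Lemma sign_mxK m (M : 'M[C]_(n, m)) : sign_mx N *m (sign_mx N *m M) = M.
Proof.
by apply/matrixP => i j; rewrite !mul_diag_mx !mxE mulrA -expr2 sqrr_sign mul1r.
Qed.

Local Notation Q := (toC (invmx P) : 'M[C]_n).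

Lemma invgramian_right_ev j :
  Q *m x j = NC.[- lambda j] *: (sign_mx N *m y j).
Proof.
have QP : Q *m PC = 1%:M by rewrite -map_mxM mulVmx ?gramian_unit // map_mx1.
suff xE : x j = PC *m (NC.[- lambda j] *: (sign_mx N *m y j)).
  by rewrite {1}xE mulmxA QP mul1mx.
rewrite -(scalemxAr NC.[_]) mulmxA -sign_gramian -mulmxA gramian_left_ev right_evN.
rewrite scaleNr scalerN opprK -(scalemxAr (_^-1)) scalerA.
by rewrite mulfV ?NC_opp_lambda_neq0 // scale1r sign_mxK.
Qed.

(** The Cauchy-like form of P^-1 in the eigenbasis. The point m is arbitrary,
    so that it can be taken to be the conjugate of an eigenvalue. *)
Lemma invgramian_form m j :
  (lambda j + m) * ((right_ev N m)^T *m Q *m x j) 0 0 =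
  - (NC.[- m] * NC.[- lambda j]).
Proof.
rewrite -mulmxA invgramian_right_ev -(scalemxAr NC.[_]) mxE mulrCA mulmxA.
have -> : (right_ev N m)^T *m sign_mx N = - (right_ev N (- m))^T.
  rewrite -[sign_mx N]tr_diag_mx -trmx_mul right_evN.
  by apply/rowP => k; rewrite !mxE opprK.
rewrite mulNmx mxE -[_ *m _]trmxK mxE trmx_mul trmxK mulrN mulrN; congr (- _).
have := left_right_ev_neq (lambda_neq0 j) (lambda_root j) (- m).
rewrite opprK => ->; exact: mulrC.
Qed.

(** * Components of the minimum energy *)

Lemma component_right_ev (v : 'cV[C]_n) i :
  residue N (lambda i) *m v = ((- N' i)^-1 * ((y i)^T *m v) 0 0) *: x i.
Proof.
rewrite residueE -scalemxAl -mulmxA [X in _ *m X]mx11_scalar mul_mx_scalar.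
by rewrite scalerA.
Qed.

Lemma deriv_NC_conj l : NC^`().[l^*] = NC^`().[l]^*.
Proof.
rewrite !horner_coef rmorph_sum; apply: eq_bigr => k _.
rewrite rmorphM rmorphXn coef_deriv coefNC -rmorphMn /=; congr (_ * _).
exact/esym/conjc_real.
Qed.

Lemma right_ev_conj l : (right_ev N l)^t* = (right_ev N l^*)^T.
Proof. by apply/rowP => k; rewrite !mxE rmorphXn. Qed.

Lemma toC_conj p q (M : 'M[R]_(p, q)) : (toC M)^t* = (toC M)^T.
Proof. by apply/matrixP => k j; rewrite !mxE; exact: conjc_real. Qed.

Lemma invgramian_sym : Q^T = Q.
Proof. by rewrite map_trmx trmx_inv gramian_sym. Qed.

Lemma trmxC_mul p q r (M : 'M[C]_(p, q)) (M' : 'M[C]_(q, r)) :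
  (M *m M')^t* = M'^t* *m M^t*.
Proof. by rewrite trmx_mul map_mxM. Qed.

Lemma invgramian_conj (u v : 'cV[C]_n) :
  (u^t* *m Q *m v) 0 0 = ((v^t* *m Q *m u) 0 0)^*.
Proof.
transitivity ((v^t* *m Q *m u)^t* 0 0); last by rewrite !mxE.
by rewrite !trmxC_mul trmxCK toC_conj invgramian_sym mulmxA.
Qed.

Lemma hermpart_form (x0 : 'cV[R]_n) (M : 'M[C]_n) (z0 := toC x0) :
  (z0^T *m hermpart M *m z0) 0 0 =
  2^-1 * ((z0^T *m M *m z0) 0 0 + ((z0^T *m M *m z0) 0 0)^*).
Proof.
rewrite /hermpart -(scalemxAr (2^-1)) -(scalemxAl (2^-1)) mxE; congr (_ * _).
rewrite mulmxDr mulmxDl mxE; congr (_ + _).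
transitivity ((z0^T *m M *m z0)^t* 0 0); last by rewrite !mxE.
by rewrite -toC_conj !trmxC_mul trmxCK mulmxA.
Qed.

Lemma addrJ_real (w : C) : 2^-1 * (w + w^*) \is Num.real.
Proof.
rewrite rpredM ?rpredV ?realn // CrealE rmorphD /= conjCK addrC.
by rewrite eqxx.
Qed.

Lemma rank1_form k (u b : 'rV[C]_n) (a v : 'cV[C]_n) :
  (u *m (k *: (a *m b)) *m v) 0 0 = k * ((u *m a) 0 0 * (b *m v) 0 0).
Proof.
rewrite -(scalemxAr k) -(scalemxAl k) mxE; congr (_ * _).
by rewrite mulmxA -[u *m a *m b *m v]mulmxA mxE big_ord1.
Qed.

Lemma sesqui_scale (M : 'M[C]_n) (c d : C) (u v : 'cV[C]_n) :
  ((c *: u)^t* *m M *m (d *: v)) 0 0 = c^* * d * (u^t* *m M *m v) 0 0.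
Proof.
have -> : (c *: u)^t* = c^* *: u^t*.
  by apply/matrixP => r s; rewrite !mxE rmorphM.
by rewrite -!(scalemxAl c^*) -(scalemxAr d) mxE [X in _ * X]mxE mulrA.
Qed.

Lemma form_half_sum (u v : 'cV[C]_n) (w : C) : w = (u^t* *m Q *m v) 0 0 ->
  2^-1 * (w + w^*) = 2^-1 * (u^t* *m Q *m v + v^t* *m Q *m u) 0 0.
Proof. by move=> ->; rewrite [X in _ = _ * X]mxE -invgramian_conj. Qed.

Lemma lambda_conjD_neq0 i j : (lambda i)^* + lambda j != 0.
Proof.
apply: contraTneq (ltrD (lambda_stable i) (lambda_stable j)) => ij.
by rewrite -Re_conj -raddfD ij raddf0 addr0 ltxx.
Qed.

Lemma invgramian_sesqui i j :
  ((x i)^t* *m Q *m x j) 0 0 =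
  - (NC.[- (lambda i)^*] * NC.[- lambda j]) / ((lambda i)^* + lambda j).
Proof.
apply: (canRL (mulfK _)); first exact: lambda_conjD_neq0.
by rewrite right_ev_conj mulrC [_ + lambda j]addrC invgramian_form.
Qed.

(** Stated for abstract vectors so that rewriting never has to compare two
    unfolded eigenvectors. *)
Lemma component_sesqui (u v : 'cV[C]_n) (c d : C) i j :
  u = c *: x i -> v = d *: x j ->
  (u^t* *m Q *m v) 0 0 = c^* * d *
    (- (NC.[- (lambda i)^*] * NC.[- lambda j]) / ((lambda i)^* + lambda j)).
Proof.
move=> -> ->; apply: etrans (sesqui_scale _ _ _ _ _) _.
exact: congr1 (invgramian_sesqui i j).
Qed.

Lemma pair_coefficient (a b ni nj l s t q : C) :
  ni != 0 -> nj != 0 -> l != 0 -> q = s^* ->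
  a * b / (- ni^* * nj) / l * (q * t) =
  ((- ni)^-1 * s)^* * ((- nj)^-1 * t) * (- (a * b) / l).
Proof.
move=> ni0 nj0 l0 ->; rewrite rmorphM fmorphV rmorphN /=.
have nic0 : ni^* != 0 by rewrite conjC_eq0.
by field; rewrite nic0 nj0 l0.
Qed.

Section State.
Variable x0 : 'cV[R]_n.
Local Notation z0 := (toC x0 : 'cV[C]_n).
Local Notation z i := (residue N (lambda i) *m z0).

Lemma sum_component : z0 = \sum_i z i.
Proof. by rewrite -mulmx_suml sum_residue mul1mx. Qed.

Lemma energyC :
  ((x0^T *m invmx P *m x0) 0 0)%:C = (z0^t* *m Q *m z0) 0 0.
Proof. by rewrite toC_conj map_trmx -!map_mxM [RHS]mxE. Qed.

Lemma Ptilde_form i :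
  (z0^T *m Ptilde N (lambda i) *m z0) 0 0 =
  2^-1 * ((z i)^t* *m Q *m z0 + z0^t* *m Q *m z i) 0 0.
Proof.
rewrite hermpart_form [_ + z0^t* *m _ *m _]addrC; apply: form_half_sum.
rewrite rank1_form toC_conj component_right_ev -(scalemxAr (_ * _)).
rewrite [RHS]mxE -[in RHS]mulmxA invgramian_right_ev -(scalemxAr NC.[_]).
rewrite [X in _ = _ * X]mxE.
move: (((y i)^T *m z0) 0 0) ((z0^T *m (sign_mx N *m y i)) 0 0) => s t; ring.
Qed.

Lemma Ppair_form i j :
  (z0^T *m Ppair N (lambda i) (lambda j) *m z0) 0 0 =
  2^-1 * ((z i)^t* *m Q *m z j + (z j)^t* *m Q *m z i) 0 0.
Proof.
rewrite hermpart_form; apply: form_half_sum.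
apply: etrans (esym (component_sesqui (component_right_ev z0 i)
  (component_right_ev z0 j))).
apply: etrans (rank1_form _ _ _ _ _) _; rewrite deriv_NC_conj.
apply: pair_coefficient; rewrite ?deriv_lambda_neq0 ?lambda_conjD_neq0 //.
transitivity (((y i)^T *m z0)^t* 0 0); last by rewrite !mxE.
rewrite trmxC_mul toC_conj; congr ((_ *m _) 0 0).
by apply/matrixP => r s; rewrite !mxE.
Qed.

End State.
End Gramian.

(** * The adjoint flow *)

Lemma residue_trmx_eigen (v : 'cV[C]_n) k :
  A^T *m ((residue N (lambda k))^T *m v) =
  lambda k *: ((residue N (lambda k))^T *m v).
Proof.
have -> : (residue N (lambda k))^T = (- N' k)^-1 *: (y k *m (x k)^T).
  by rewrite residueE linearZ /= trmx_mul trmxK.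
rewrite -(scalemxAl (_^-1)) -(scalemxAr (_^-1)) !mulmxA companion_left_ev ?lambda_neq0 //.
by rewrite -!(scalemxAl (lambda k)) !scalerA mulrC.
Qed.

(** The adjoint flow is e^(- A^T t) q, written on the spectral decomposition
    of A^T; every mode e^(- lambda_k t) decays backwards in time. *)
Lemma exists_costate (q : 'cV[R]_n) :
  exists p : R -> 'cV[R]_n,
  [/\ forall (t : R) i, is_derive t 1 (fun r => p r i 0)
        ((- ((companionmx N)^T *m p t)) i 0),
      (forall i, p t i 0 @[t --> -oo] --> (0 : R))%classic & p 0 = q].
Proof.
pose c k : 'cV[C]_n := (residue N (lambda k))^T *m toC q.
have pE (t : R) i : (\col_j \sum_k mode (c k j 0) (- lambda k) t) i 0 =
    \sum_k mode (c k i 0) (- lambda k) t by rewrite mxE.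
exists (fun t => \col_i \sum_k mode (c k i 0) (- lambda k) t); split.
- move=> t i; under [X in is_derive _ _ X]eq_fun do rewrite pE.
  have -> : (- ((companionmx N)^T *m \col_j \sum_k mode (c k j 0) (- lambda k) t)) i 0 =
      \sum_k mode (- lambda k * c k i 0) (- lambda k) t.
    rewrite !mxE -sumrN.
    transitivity (\sum_j \sum_k - companionmx N j i * mode (c k j 0) (- lambda k) t).
      by apply: eq_bigr => j _; rewrite !mxE -mulNr mulr_sumr.
    rewrite exchange_big; apply: eq_bigr => k _ /=.
    have /colP/(_ i) := residue_trmx_eigen (toC q) k.
    rewrite mxE [RHS]mxE mulNr => <-.
    rewrite -sumrN mode_sum; apply: eq_bigr => j _.
    by rewrite -modeZ; congr mode; rewrite rmorphN mulNr !mxE.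
  by apply: is_derive_sumE => k; exact: is_derive_mode.
- move=> i; under eq_fun do rewrite pE.
  apply: cvg_sum0 => k; apply: mode_cvg0.
  by have := lambda_stable k; rewrite -complexRe ltcR raddfN oppr_gt0.
- apply/colP => i; rewrite pE.
  rewrite (eq_bigr (fun k => complex.Re (c k i 0))) => [|k _]; last exact: mode0.
  have : \sum_k c k = toC q.
    by rewrite -mulmx_suml -(raddf_sum trmx) sum_residue /= trmx1 mul1mx.
  move=> /colP/(_ i); rewrite summxE mxE => /(congr1 (@complex.Re R)).
  by rewrite raddf_sum.
Qed.

End Spectrum.
End CompanionEigenvectors.

Theorem mainTheorem9 (R : realType) (N : {poly R})
    (lambda : 'I_(size N).-1 -> R[i])
    (x0 : 'cV[R]_(size N).-1) (P : 'M[R]_((size N).-1)) :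
  N \is monic -> (1 < size N)%N ->
  injective lambda ->
  (forall i, eigenvalue (toC (companionmx N)) (lambda i)) ->
  (forall i, 'Re (lambda i) < 0) ->
  reachable (companionmx N) (e_last N) x0 ->
  companionmx N *m P + P *m (companionmx N)^T = - (e_last N *m (e_last N)^T) ->
  let Emin : R := (x0^T *m invmx P *m x0) 0 0 in
  let z0 : 'cV[R[i]]_(size N).-1 := toC x0 in
  let Q : 'M[R[i]]_((size N).-1) := toC (invmx P) in
  let z i : 'cV[R[i]]_(size N).-1 := residue N (lambda i) *m z0 in
  let E i : R[i] := (z0^T *m Ptilde N (lambda i) *m z0) 0 0 in
  let Ehat i j : R[i] :=
    (z0^T *m Ppair N (lambda i) (lambda j) *m z0) 0 0 in
  [/\ P \in unitmx,
      is_min_energy (companionmx N) (e_last N) x0 Emin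
    & z0 = \sum_i z i] /\
  [/\ forall i, E i \is Num.real,
      forall i j, Ehat i j \is Num.real,
      Emin%:C = \sum_i E i
    & Emin%:C = \sum_i \sum_j Ehat i j] /\
  (forall i,
     E i = 2^-1 * ((z i) ^t* *m Q *m z0 + z0 ^t* *m Q *m z i) 0 0) /\
  (forall i j,
     Ehat i j = 2^-1 * ((z i) ^t* *m Q *m z j + (z j) ^t* *m Q *m z i) 0 0).
Proof.
move=> Nmonic Nsize lambda_inj lambda_eigen lambda_stable _ lyapunov /=.
have lambda_root i : root (NC N) (lambda i).
  have := lambda_eigen i.
  by rewrite eigenvalue_root_char -map_char_poly companionmxK.
have Punit := gramian_unit Nmonic Nsize lambda_inj lambda_root lambda_stable lyapunov.
have Psym := gramian_sym Nmonic Nsize lambda_inj lambda_root lambda_stable lyapunov.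
have z0E := sum_component Nmonic Nsize lambda_inj lambda_root lambda_stable x0.
have EE := Ptilde_form Nmonic Nsize lambda_inj lambda_root lambda_stable lyapunov x0.
have EhatE := Ppair_form Nmonic Nsize lambda_inj lambda_root lambda_stable lyapunov x0.
pose z i : 'cV[R[i]]_(size N).-1 := residue N (lambda i) *m toC x0.
have zCE : (toC x0)^t* = \sum_i (z i)^t*.
  by rewrite {1}z0E (raddf_sum trmx) (raddf_sum (map_mx Num.conj)).
(* Summing the second index of the second partition, or the only index of the
   first one, replaces a component by the whole state. *)
have half_sum (w : 'cV[R[i]]_(size N).-1) :
    \sum_i 2^-1 * (w^t* *m toC (invmx P) *m z i
                   + (z i)^t* *m toC (invmx P) *m w) 0 0 =
    2^-1 * (w^t* *m toC (invmx P) *m toC x0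
            + (toC x0)^t* *m toC (invmx P) *m w) 0 0.
  rewrite -mulr_sumr -summxE big_split /= -mulmx_sumr -z0E.
  by rewrite -!mulmx_suml -zCE.
have EminE : ((x0^T *m invmx P *m x0) 0 0)%:C =
    \sum_i ((toC x0)^T *m Ptilde N (lambda i) *m toC x0) 0 0.
  under eq_bigr => i _ do rewrite EE addrC.
  rewrite half_sum energyC [X in _ = _ * X]mxE -mulr2n -[X in _ * X]mulr_natl.
  by rewrite mulKf ?pnatr_eq0.
split; [split=> //|split; [split|by split]].
- have [p [p_ode p_lim p_0]] := exists_costate Nmonic Nsize lambda_inj lambda_root
    lambda_stable (invmx P *m x0).
  apply: (costate_min_energy Psym Punit lyapunov p_ode p_lim).
  by rewrite p_0 mulmxA mulmxV // mul1mx.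
- by move=> i; rewrite hermpart_form addrJ_real.
- by move=> i j; rewrite hermpart_form addrJ_real.
- exact: EminE.
- apply: etrans EminE _; apply: eq_bigr => i _; apply: etrans (EE i) _.
  apply: etrans (esym (half_sum (z i))) _.
  by apply: eq_bigr => j _; exact: esym (EhatE i j).
Qed.
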